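(* (a) Let $B\in\mathbb{R}^{n_u\times n_u}$, $M\in\mathbb{R}^{n_u\times n_\sigma}$, $H\in\mathbb{R}^{n_g\times n_u}$, $F\in\mathbb{R}^{n_u}$, $g\in\mathbb{R}^{n_g}$ and $\alpha\ge 0$, and assume that $\rho(B)<1$ and that $H(I-B)^{-1}M$ is injective. Then the semi-implicit one-step one-shot method $$\sigma^{n+1}=\sigma^n-\tau M^*p^n-\tau\alpha\sigma^{n+1},\qquad u^{n+1}=Bu^n+M\sigma^{n+1}+F,\qquad p^{n+1}=B^*p^n+H^*(Hu^n-g)$$ converges for all sufficiently small $\tau>0$ (i.e. there is $\tau_0>0$ such that it converges for every $0<\tau<\tau_0$). (b) In particular, there exist a piecewise polynomial function $\mathcal{P}_1$ of degree at most $4$ with $\mathcal{P}_1>0$ on $[0,1)$ and a constant $C>0$, both independent of $B,M,H,F,g,\alpha$ and of the dimensions $n_u,n_\sigma,n_g$, such that for all data as in (a) with moreover $\|B\|<1$, the method converges for every $\tau>0$ satisfying $$\tau<\left(\frac{\|H\|^2\|M\|^2}{(1-\|B\|)^4}\,\mathcal{P}_1(\|B\|)+C\alpha\right)^{-1}.$$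
   Context: $\|\cdot\|$ is the Euclidean vector norm and the induced matrix norm, $A^*$ is the conjugate transpose (here the transpose), $\rho$ is the spectral radius. For $\sigma\in\mathbb{R}^{n_\sigma}$, let $u(\sigma)$ be the unique solution of $u=Bu+M\sigma+F$ and $p(\sigma)$ the unique solution of $p=B^*p+H^*(Hu(\sigma)-g)$. Let $\sigma^{\mathrm{ex}}_\alpha$ be the (unique) minimizer over $\sigma\in\mathbb{R}^{n_\sigma}$ of $J(\sigma)=\frac12\|Hu(\sigma)-g\|^2+\frac{\alpha}{2}\|\sigma\|^2$. The method ''converges'' means: for every initial guess $(\sigma^0,u^0,p^0)$, the sequence $(\sigma^n,u^n,p^n)$ converges to $(\sigma^{\mathrm{ex}}_\alpha,u(\sigma^{\mathrm{ex}}_\alpha),p(\sigma^{\mathrm{ex}}_\alpha))$. ''Piecewise polynomial of degree at most $d$'' on $[0,1)$ means that $[0,1)$ can be divided into finitely many intervals on each of which the function is a polynomial of degree at most $d$. *)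

(* Defs.v *)
From HB Require Import structures.
From mathcomp Require Import all_boot all_order all_algebra.
From mathcomp Require Import complex.
From mathcomp Require Import all_classical all_reals all_analysis.

Set Implicit Arguments.
Unset Strict Implicit.
Unset Printing Implicit Defensive.

Import Order.TTheory GRing.Theory Num.Theory.
Import numFieldNormedType.Exports.

Local Open Scope classical_set_scope.
Local Open Scope ring_scope.

(* MathComp-Analysis norms 'M[R]_(m, n) by the maximum of the entries, so the
   Euclidean norm and the matrix norm it induces are defined here. *)
Definition vnorm (R : realType) (n : nat) (x : 'cV[R]_n) : R :=
  Num.sqrt (\sum_(i < n) x i 0 ^+ 2).

(* The constraint is vnorm x <= 1, not vnorm x = 1, so that the set is nonempty
   also when n = 0. *)
Definition opnorm (R : realType) (m n : nat) (A : 'M[R]_(m, n)) : R :=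
  sup [set vnorm (A *m x) | x in [set x : 'cV[R]_n | vnorm x <= 1]].

(* Largest modulus of a complex eigenvalue; [eigenvalue] is about row vectors,
   which gives the same spectrum. *)
Definition spectral_radius (R : realType) (n : nat) (A : 'M[R]_n) : R :=
  sup [set complex.Re `|z| |
       z in [set z : R[i] | eigenvalue (map_mx (real_complex R) A) z]].

Definition piecewise_poly (R : realType) (d : nat) (P : R -> R) : Prop :=
  exists (k : nat) (I : 'I_k -> interval R) (q : 'I_k -> {poly R}),
    [/\ \bigcup_i [set` I i] = [set x | 0 <= x < 1],
        trivIset setT (fun i => [set` I i]),
        forall i, (size (q i) <= d.+1)%N &
        forall i x, x \in I i -> P x = (q i).[x]].

Section OneShot.
Variables (R : realType) (nu ns ng : nat).
Variables (B : 'M[R]_nu) (M : 'M[R]_(nu, ns)) (H : 'M[R]_(ng, nu)).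
Variables (F : 'cV[R]_nu) (g : 'cV[R]_ng) (alpha : R).

Definition admissible : Prop :=
  [/\ 0 <= alpha, spectral_radius B < 1 &
      injective (fun s : 'cV[R]_ns => H *m invmx (1%:M - B) *m M *m s)].

(* [xget 0 A] is an element of A, and 0 if A is empty; for admissible data each
   of the three sets below is a singleton. *)
Definition state (s : 'cV[R]_ns) : 'cV[R]_nu :=
  xget 0 [set u | u = B *m u + M *m s + F].

Definition adjoint_state (s : 'cV[R]_ns) : 'cV[R]_nu :=
  xget 0 [set p | p = B^T *m p + H^T *m (H *m state s - g)].

Definition cost (s : 'cV[R]_ns) : R :=
  2^-1 * vnorm (H *m state s - g) ^+ 2 + alpha / 2 * vnorm s ^+ 2.

Definition sigma_ex : 'cV[R]_ns :=
  xget 0 [set s | forall s', cost s <= cost s'].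

Definition one_shot_iterates (tau : R) (sigma : nat -> 'cV[R]_ns)
    (u p : nat -> 'cV[R]_nu) : Prop :=
  forall n, [/\
    sigma n.+1
      = sigma n - tau *: (M^T *m p n) - (tau * alpha) *: sigma n.+1,
    u n.+1 = B *m u n + M *m sigma n.+1 + F &
    p n.+1 = B^T *m p n + H^T *m (H *m u n - g)].

(* The step for sigma is implicit; as 1 + tau * alpha > 0, each initial guess
   (sigma 0, u 0, p 0) extends to exactly one triple of iterates. *)
Definition one_shot_converges (tau : R) : Prop :=
  forall (sigma : nat -> 'cV[R]_ns) (u p : nat -> 'cV[R]_nu),
    one_shot_iterates tau sigma u p ->
    [/\ sigma n @[n --> \oo] --> sigma_ex,
        u n @[n --> \oo] --> state sigma_ex &
        p n @[n --> \oo] --> adjoint_state sigma_ex].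

End OneShot.

(* Main.v *)
(* Let G = (1 - B)^-1 and K = H G M, so that the Hessian of the cost is
   K^* K + alpha. Write e for the error in sigma, d for its increment over one
   step, and measure u and p by their lags v and q behind the state and adjoint
   state of the current sigma. Then
     d = - tau (K^* K e + alpha e' + M^* q),
     v' = B v - B G M d,   q' = B^* q + H^* H v - G^* H^* K d,
   that is, a semi-implicit gradient step perturbed by a lag, and a lag which is
   contracted by B and B^* and fed only by d. Hence
     |K e|^2 / 2 + alpha |e|^2 / 2 + c N2(q)^2 + c' N1(v)^2
   decreases by a positive multiple of |d|^2 + N2(q)^2 + N1(v)^2 when tau is small,
   N1 and N2 being norms contracted by B and B^*. So d, v and q tend to 0, and
   e follows as K^* K + alpha is invertible. If |B| < 1, the Euclidean norm and
   c = (1 - |B|)^2 / |H|^2 give the condition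
     7 |H|^2 |M|^2 / (1 - |B|)^3 < 1 / tau,
   so that P1 = 7 and C = 1 will do. *)
Require Import Defs.
From HB Require Import structures.
From mathcomp Require Import all_boot all_order all_algebra.
From mathcomp Require Import complex.
From mathcomp Require Import all_classical all_reals all_analysis.
From mathcomp Require Import ring lra.
Import Order.TTheory GRing.Theory Num.Theory.
Import numFieldNormedType.Exports Normc.
Local Open Scope classical_set_scope.
Local Open Scope ring_scope.

Set Implicit Arguments.
Unset Strict Implicit.
Unset Printing Implicit Defensive.

(** * Euclidean inner product, norm and induced matrix norm *)

Section EuclideanNorm.
Variable R : realType.

Definition dot n (x y : 'cV[R]_n) : R := (x^T *m y) 0 0.

Lemma dotE n (x y : 'cV[R]_n) : dot x y = \sum_i x i 0 * y i 0.
Proof. by rewrite /dot mxE; apply: eq_bigr => i _; rewrite mxE. Qed.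

Lemma dotC n (x y : 'cV[R]_n) : dot x y = dot y x.
Proof. by rewrite !dotE; apply: eq_bigr => i _; rewrite mulrC. Qed.

Lemma dotDl n (x y z : 'cV[R]_n) : dot (x + y) z = dot x z + dot y z.
Proof. by rewrite /dot linearD mulmxDl mxE. Qed.

Lemma dotDr n (x y z : 'cV[R]_n) : dot x (y + z) = dot x y + dot x z.
Proof. by rewrite /dot mulmxDr mxE. Qed.

Lemma dotZl n a (x y : 'cV[R]_n) : dot (a *: x) y = a * dot x y.
Proof. by rewrite /dot linearZ /= -scalemxAl mxE. Qed.

Lemma dotZr n a (x y : 'cV[R]_n) : dot x (a *: y) = a * dot x y.
Proof. by rewrite dotC dotZl dotC. Qed.

Lemma dotNl n (x y : 'cV[R]_n) : dot (- x) y = - dot x y.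
Proof. by rewrite -scaleN1r dotZl mulN1r. Qed.

Lemma dotNr n (x y : 'cV[R]_n) : dot x (- y) = - dot x y.
Proof. by rewrite dotC dotNl dotC. Qed.

Lemma dot_mulmx m n (A : 'M[R]_(m, n)) x y : dot x (A *m y) = dot (A^T *m x) y.
Proof. by rewrite /dot trmx_mul trmxK mulmxA. Qed.

Lemma vnorm_ge0 n (x : 'cV[R]_n) : 0 <= vnorm x.
Proof. exact: sqrtr_ge0. Qed.

Lemma vnorm_sqr n (x : 'cV[R]_n) : vnorm x ^+ 2 = dot x x.
Proof.
rewrite /vnorm sqr_sqrtr; last by apply: sumr_ge0 => i _; exact: sqr_ge0.
by rewrite dotE; apply: eq_bigr => i _; rewrite expr2.
Qed.

Lemma vnorm_eq0 n (x : 'cV[R]_n) : vnorm x = 0 -> x = 0.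
Proof.
move=> x0; have := vnorm_sqr x; rewrite x0 expr0n dotE => /esym /eqP.
rewrite psumr_eq0 => [/allP h|i _]; last by rewrite -expr2 sqr_ge0.
apply/matrixP => i j; rewrite ord1 mxE.
have := h i (mem_index_enum i).
by rewrite mulf_eq0 orbb => /eqP.
Qed.

Lemma vnorm0 n : vnorm (0 : 'cV[R]_n) = 0.
Proof. by apply/eqP; rewrite -sqrf_eq0 vnorm_sqr /dot mulmx0 mxE. Qed.

Lemma vnormZ n a (x : 'cV[R]_n) : vnorm (a *: x) = `|a| * vnorm x.
Proof.
apply/eqP; rewrite -(@eqrXn2 _ 2) ?vnorm_ge0 ?mulr_ge0 ?vnorm_ge0//.
by rewrite exprMn !vnorm_sqr dotZl dotZr real_normK ?num_real// mulrA expr2.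
Qed.

Lemma vnormN n (x : 'cV[R]_n) : vnorm (- x) = vnorm x.
Proof. by rewrite -scaleN1r vnormZ normrN1 mul1r. Qed.

(** Cauchy-Schwarz: the squared norm of |y|^2 x - <x, y> y is |y|^2 times |x|^2 |y|^2 - <x, y>^2. *)
Lemma dot_le_vnorm n (x y : 'cV[R]_n) : dot x y <= vnorm x * vnorm y.
Proof.
have [/vnorm_eq0 ->|y0] := eqVneq (vnorm y) 0.
  by rewrite vnorm0 mulr0 /dot mulmx0 mxE.
have y2 : 0 < vnorm y ^+ 2 by rewrite exprn_gt0// lt_def y0 vnorm_ge0.
apply: le_trans (ler_norm _) _.
rewrite -(@ler_pXn2r _ 2) ?nnegrE ?mulr_ge0 ?vnorm_ge0// real_normK ?num_real//.
rewrite -subr_ge0 -(pmulr_rge0 _ y2).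
have := sqr_ge0 (vnorm (vnorm y ^+ 2 *: x - dot x y *: y)).
rewrite (vnorm_sqr (_ - _)) !(dotDl, dotDr, dotNl, dotNr, dotZl, dotZr) (dotC y x).
by rewrite -!vnorm_sqr; congr (0 <= _); ring.
Qed.

Lemma vnorm_sqrD n (x y : 'cV[R]_n) :
  vnorm (x + y) ^+ 2 = vnorm x ^+ 2 + 2 * dot x y + vnorm y ^+ 2.
Proof. by rewrite !vnorm_sqr !(dotDl, dotDr) (dotC y x); ring. Qed.

Lemma vnormD n (x y : 'cV[R]_n) : vnorm (x + y) <= vnorm x + vnorm y.
Proof.
rewrite -(@ler_pXn2r _ 2) ?nnegrE ?addr_ge0 ?vnorm_ge0//.
by rewrite vnorm_sqrD; have := dot_le_vnorm x y; lra.
Qed.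

Lemma vnormB n (x y : 'cV[R]_n) : vnorm (x - y) <= vnorm x + vnorm y.
Proof. by rewrite -(vnormN y) vnormD. Qed.

Lemma ler_entry_vnorm n (x : 'cV[R]_n) i : `|x i 0| <= vnorm x.
Proof.
rewrite -(@ler_pXn2r _ 2) ?nnegrE ?vnorm_ge0// real_normK ?num_real//.
rewrite vnorm_sqr dotE (bigD1 i) //= -expr2 lerDl.
by apply: sumr_ge0 => j _; rewrite -expr2 sqr_ge0.
Qed.

Lemma vnorm_le_sum n (x : 'cV[R]_n) : vnorm x <= \sum_i `|x i 0|.
Proof.
rewrite -(@ler_pXn2r _ 2) ?nnegrE ?vnorm_ge0 ?sumr_ge0//.
rewrite vnorm_sqr dotE expr2 mulr_suml; apply: ler_sum => i _.
apply: le_trans (ler_norm _) _; rewrite normrM ler_wpM2l//.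
by rewrite (bigD1 i)//= lerDl sumr_ge0.
Qed.

(** Makes the set whose supremum is [opnorm] bounded above; any constant would do. *)
Lemma vnorm_mulmx_bounded m n (A : 'M[R]_(m, n)) :
  exists k, forall x, vnorm (A *m x) <= k * vnorm x.
Proof.
exists (\sum_i \sum_j `|A i j|) => x; apply: le_trans (vnorm_le_sum _) _.
rewrite mulr_suml; apply: ler_sum => i _; rewrite mxE mulr_suml.
apply: le_trans (ler_norm_sum _ _ _) _; apply: ler_sum => j _.
by rewrite normrM ler_wpM2l// ler_entry_vnorm.
Qed.

Lemma le_opnorm m n (A : 'M[R]_(m, n)) x : vnorm x <= 1 -> vnorm (A *m x) <= opnorm A.
Proof.
move=> x1; apply: ub_le_sup; last by exists x.
have [k kP] := vnorm_mulmx_bounded A; exists `|k| => _ [z /= z1 <-].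
apply: le_trans (kP z) _; apply: le_trans (_ : `|k| * vnorm z <= _).
  by rewrite ler_wpM2r ?vnorm_ge0 ?ler_norm.
by rewrite ler_piMr.
Qed.

Lemma opnorm_ge0 m n (A : 'M[R]_(m, n)) : 0 <= opnorm A.
Proof. by apply: le_trans (@le_opnorm _ _ A 0 _); rewrite ?vnorm_ge0 ?vnorm0. Qed.

Lemma vnorm_mulmx m n (A : 'M[R]_(m, n)) x :
  vnorm (A *m x) <= opnorm A * vnorm x.
Proof.
have [/vnorm_eq0 ->|x0] := eqVneq (vnorm x) 0.
  by rewrite mulmx0 !vnorm0 mulr0.
have x1 : 0 < vnorm x by rewrite lt_def x0 vnorm_ge0.
have := @le_opnorm _ _ A ((vnorm x)^-1 *: x).
rewrite -scalemxAr !vnormZ ger0_norm ?invr_ge0 ?vnorm_ge0// mulVf//.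
by move=> /(_ (lexx _)); rewrite mulrC ler_pdivrMr.
Qed.

(** |A^T x|^2 = <x, A A^T x> <= |x| |A| |A^T x|, and one factor |A^T x| cancels. *)
Lemma vnorm_trmulmx m n (A : 'M[R]_(m, n)) x :
  vnorm (A^T *m x) <= opnorm A * vnorm x.
Proof.
have [->|y0] := eqVneq (vnorm (A^T *m x)) 0.
  by rewrite mulr_ge0 ?opnorm_ge0 ?vnorm_ge0.
have y1 : 0 < vnorm (A^T *m x) by rewrite lt_def y0 vnorm_ge0.
rewrite -(ler_pM2l y1) -expr2 vnorm_sqr -dot_mulmx.
apply: le_trans (dot_le_vnorm _ _) _.
rewrite mulrA [X in _ <= X]mulrC ler_wpM2l ?vnorm_ge0//.
by rewrite [X in _ <= X]mulrC vnorm_mulmx.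
Qed.

(** The topology on matrices comes from the maximum of the entries, which the Euclidean norm
    dominates. *)
Lemma cvg_vnorm n (x : nat -> 'cV[R]_n) (l : 'cV[R]_n) :
  vnorm (x k - l) @[k --> \oo] --> (0 : R) -> x k @[k --> \oo] --> l.
Proof.
move=> xl; apply/cvgrPdist_le => e e0; near=> k.
have xk : vnorm (x k - l) <= e.
  apply: le_trans (ler_norm _) _; near: k.
  by move/cvgr0_norm_le : xl; exact.
rewrite [leLHS]/Num.Def.normr/= mx_normrE (bigmax_le _ (ltW e0))//= => -[i j] _ /=.
rewrite (ord1 j); apply: le_trans (ler_entry_vnorm _ _) _.
by rewrite -vnormN opprB.
Unshelve. all: by end_near. Qed.

End EuclideanNorm.

(** * A norm contracted by a matrix of spectral radius below 1 *)

Section ContractingNorm.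
Variable R : realType.
Let C := R[i].

Definition l1norm n (w : 'cV[C]_n) : R := \sum_i normc (w i 0).

Lemma normc_ge0 (z : C) : 0 <= normc z.
Proof. by case: z => a b; exact: sqrtr_ge0. Qed.

Lemma normc_real (a : R) : normc (real_complex R a) = `|a|.
Proof. by rewrite /= expr0n addr0 sqrtr_sqr. Qed.

Lemma le_normc_sum I (r : seq I) (f : I -> C) :
  normc (\sum_(i <- r) f i) <= \sum_(i <- r) normc (f i).
Proof.
elim/big_ind2 : _ => //; first by rewrite normc0.
by move=> z a w b za wb; apply: le_trans (le_normcD _ _) _; exact: lerD.
Qed.

Lemma l1norm_ge0 n (w : 'cV[C]_n) : 0 <= l1norm w.
Proof. by apply: sumr_ge0 => i _; exact: normc_ge0. Qed.

Lemma l1normD n (v w : 'cV[C]_n) : l1norm (v + w) <= l1norm v + l1norm w.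
Proof. by rewrite -big_split; apply: ler_sum => i _; rewrite mxE le_normcD. Qed.

Lemma l1normB n (v w : 'cV[C]_n) : l1norm (v - w) <= l1norm v + l1norm w.
Proof.
rewrite -big_split; apply: ler_sum => i _; rewrite !mxE.
by apply: le_trans (le_normcD _ _) _; rewrite normcN.
Qed.

Lemma l1normZ n z (w : 'cV[C]_n) : l1norm (z *: w) = normc z * l1norm w.
Proof. by rewrite mulr_sumr; apply: eq_bigr => i _; rewrite mxE normcM. Qed.

Lemma l1norm_mulmx_bounded m n (A : 'M[C]_(m, n)) :
  exists2 k, 0 <= k & forall w, l1norm (A *m w) <= k * l1norm w.
Proof.
exists (\sum_i \sum_j normc (A i j)).
  by do 2![apply: sumr_ge0 => ? _]; exact: normc_ge0.
move=> w; rewrite mulr_suml; apply: ler_sum => i _; rewrite mxE mulr_suml.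
apply: le_trans (le_normc_sum _ _) _; apply: ler_sum => j _.
rewrite normcM ler_wpM2l ?normc_ge0// /l1norm (bigD1 j)//= lerDl.
by apply: sumr_ge0 => *; exact: normc_ge0.
Qed.

(* With w_0 = w and w_(k+1) = (A - l_k) w_k for rs = [l_0; l_1; ...], this is the
   sum of the e^k |w_k|. As A w_k = l_k w_k + w_(k+1), applying A multiplies it
   by at most max |l_k| + 1/e as soon as the last w_k vanishes. *)
Fixpoint krylov_norm n (A : 'M[C]_n) (e : R) (rs : seq C) (w : 'cV[C]_n) : R :=
  if rs is l :: rs' then l1norm w + e * krylov_norm A e rs' ((A - l%:M) *m w)
  else l1norm w.

Fixpoint krylov_prod n (A : 'M[C]_n) (rs : seq C) : 'M[C]_n :=
  if rs is l :: rs' then krylov_prod A rs' *m (A - l%:M) else 1%:M.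

Lemma l1norm_le_krylov_norm n (A : 'M[C]_n) e rs w :
  0 <= e -> l1norm w <= krylov_norm A e rs w.
Proof.
move=> e0; elim: rs w => //= l rs ih w; rewrite lerDl mulr_ge0//.
exact: le_trans (l1norm_ge0 _) (ih _).
Qed.

Lemma krylov_normB n (A : 'M[C]_n) e rs v w : 0 <= e ->
  krylov_norm A e rs (v - w) <= krylov_norm A e rs v + krylov_norm A e rs w.
Proof.
move=> e0; elim: rs v w => [|l rs ih] v w /=; first exact: l1normB.
rewrite mulmxBr addrACA -mulrDr lerD ?l1normB// ler_wpM2l//; exact: ih.
Qed.

Lemma krylov_norm_bounded n (A : 'M[C]_n) e rs : 0 <= e ->
  exists2 k, 0 <= k & forall w, krylov_norm A e rs w <= k * l1norm w.
Proof.
move=> e0; elim: rs => [|l rs [k k0 kP]] /=.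
  by exists 1 => // w; rewrite mul1r.
have [k' k'0 k'P] := l1norm_mulmx_bounded (A - l%:M).
exists (1 + e * (k * k')) => [|w]; first by rewrite addr_ge0// !mulr_ge0.
rewrite mulrDl mul1r lerD2l -mulrA ler_wpM2l//.
by apply: le_trans (kP _) _; rewrite -mulrA ler_wpM2l.
Qed.

(** Induction on [rs]. The subtracted term strengthens the claim: taken at the next vector y of the
    chain and multiplied by [e], it cancels the [l1norm y] that arises from A w = l w + y. *)
Lemma krylov_norm_contracts n (A : 'M[C]_n) (e r : R) rs w : 0 < e ->
  (forall l, l \in rs -> normc l <= r) -> krylov_prod A rs *m w = 0 ->
  krylov_norm A e rs (A *m w)
    <= (r + e^-1) * krylov_norm A e rs w - e^-1 * l1norm w.
Proof.
move=> e0; elim: rs w => [|l rs ih] w /= rP.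
  rewrite mul1mx => ->; rewrite mulmx0 /l1norm big1 ?mulr0 ?subr0// => i _.
  by rewrite mxE normc0.
rewrite -mulmxA; set y := (A - l%:M) *m w => y0.
have Aw : A *m w = l *: w + y.
  by rewrite /y mulmxBl mul_scalar_mx addrC subrK.
have -> : (A - l%:M) *m (A *m w) = A *m y.
  by rewrite /y !mulmxA mulmxBl mulmxBr scalar_mxC.
have h1 : l1norm (A *m w) <= r * l1norm w + l1norm y.
  rewrite Aw; apply: le_trans (l1normD _ _) _; rewrite lerD2r l1normZ.
  by rewrite ler_wpM2r ?l1norm_ge0// rP// mem_head.
have h2 := ih y (fun k krs => rP k (@mem_behead _ (l :: rs) k krs)) y0.
have := lerD h1 (ler_wpM2l (ltW e0) h2); move=> /le_trans; apply.
rewrite le_eqVlt; apply/orP; left; apply/eqP; field.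
by rewrite gt_eqF.
Qed.

Lemma krylov_prod_horner n (A : 'M[C]_n.+1) rs :
  krylov_prod A rs = horner_mx A (\prod_(z <- rs) ('X - z%:P)).
Proof.
elim: rs => [|l rs ih] /=.
  by rewrite big_nil (rmorph1 (horner_mx A)).
by rewrite big_cons mulrC rmorphM rmorphB /= horner_mx_X horner_mx_C ih.
Qed.

(** The eigenvalues are roots of the characteristic polynomial, so the sum of the moduli of its
    roots bounds the set whose supremum is taken. *)
Lemma eigenvalue_norm_le_spectral_radius n (B : 'M[R]_n) (z : C) :
  eigenvalue (map_mx (real_complex R) B) z -> normc z <= spectral_radius B.
Proof.
move=> zB; apply: ub_le_sup; last by exists z.
have [rs prs] := closed_field_poly_normal (char_poly (map_mx (real_complex R) B)).
exists (\sum_(l <- rs) normc l) => _ [l /= lB <-].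
have : l \in rs.
  move: lB; rewrite eigenvalue_root_char prs (monicP (char_poly_monic _)) scale1r.
  by rewrite root_prod_XsubC.
move=> /(big_rem l) -> /=; rewrite lerDl.
by apply: sumr_ge0 => *; exact: normc_ge0.
Qed.

(** Passes the spectral hypothesis to [B^T], which contracts the adjoint lag in a norm of its
    own. *)
Lemma spectral_radius_trmx n (B : 'M[R]_n) :
  spectral_radius B^T = spectral_radius B.
Proof.
have h z : eigenvalue (map_mx (real_complex R) B^T) z
    = eigenvalue (map_mx (real_complex R) B) z.
  rewrite !eigenvalue_root_char /char_poly -[in LHS]det_tr linearB /= tr_scalar_mx.
  by rewrite !map_trmx trmxK.
have E : [set z : C | eigenvalue (map_mx (real_complex R) B^T) z] =
    [set z | eigenvalue (map_mx (real_complex R) B) z].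
  by apply/seteqP; split=> z /=; rewrite h.
exact: (congr1 (fun S => sup [set complex.Re `|z| | z in S]) E).
Qed.

(** Subadditivity is put in terms of differences, as the error recursions have them, and the lower
    constant is scaled to 1. *)
Definition equivalent_norm n (N : 'cV[R]_n -> R) :=
  [/\ forall x y, N (x - y) <= N x + N y,
      forall x, vnorm x <= N x &
      exists2 k, 0 <= k & forall x, N x <= k * vnorm x].

Lemma equivalent_norm_vnorm n : equivalent_norm (@vnorm R n).
Proof. by split=> [x y|//|]; [exact: vnormB | exists 1 => // x; rewrite mul1r]. Qed.

Lemma equivalent_norm_ge0 n (N : 'cV[R]_n -> R) x : equivalent_norm N -> 0 <= N x.
Proof. by case=> _ h _; exact: le_trans (vnorm_ge0 x) (h x). Qed.

(** With [rs] the roots of the characteristic polynomial, Cayley-Hamilton makes the last vector of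
    every chain vanish, so [krylov_norm] of the complexified vector contracts. *)
Lemma contracting_norm n (B : 'M[R]_n) : spectral_radius B < 1 ->
  exists N b, [/\ equivalent_norm N, 0 <= b < 1 & forall x, N (B *m x) <= b * N x].
Proof.
(* Evaluating a polynomial at a matrix requires a dimension of the form [n.+1]. *)
case: n B => [|n] B rB.
  exists (@vnorm R 0), 0; split=> [||x]; first exact: equivalent_norm_vnorm.
    by rewrite lexx ltr01.
  by rewrite [B *m x]flatmx0 vnorm0 mul0r.
set A := map_mx (real_complex R) B.
have [rs] := closed_field_poly_normal (char_poly A).
rewrite (monicP (char_poly_monic _)) scale1r => prs.
pose r := Num.max 0 (spectral_radius B).
have r0 : 0 <= r by rewrite le_max lexx.
have r1 : r < 1 by rewrite gt_max ltr01.
have rP l : l \in rs -> normc l <= r.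
  move=> lrs; rewrite le_max eigenvalue_norm_le_spectral_radius ?orbT//.
  by rewrite eigenvalue_root_char -/A prs root_prod_XsubC.
have A0 (w : 'cV[C]_n.+1) : krylov_prod A rs *m w = 0.
  by rewrite krylov_prod_horner -prs Cayley_Hamilton mul0mx.
(* This makes the rate [r + e^-1] equal to (1 + r) / 2. *)
pose e := 2 / (1 - r).
have e0 : 0 < e by rewrite divr_gt0// subr_gt0.
have eV : e^-1 = (1 - r) / 2 by rewrite /e invfM invrK mulrC.
pose N x := krylov_norm A e rs (map_mx (real_complex R) x).
have l1real (x : 'cV[R]_n.+1) :
    l1norm (map_mx (real_complex R) x) = \sum_i `|x i 0|.
  by apply: eq_bigr => i _; rewrite mxE normc_real.
exists N, (r + e^-1); split.
- split=> [x y|x|].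
  + by rewrite /N map_mxB krylov_normB// ltW.
  + apply: le_trans (vnorm_le_sum _) _; rewrite -l1real.
    by apply: l1norm_le_krylov_norm; rewrite ltW.
  + have [k k0 kP] := krylov_norm_bounded A rs (ltW e0).
    exists (k * n.+1%:R) => [|x]; first by rewrite mulr_ge0.
    apply: le_trans (kP _) _; rewrite -mulrA ler_wpM2l// l1real.
    rewrite mulr_natl -[X in _ *+ X]card_ord -sumr_const.
    by apply: ler_sum => i _; exact: ler_entry_vnorm.
- by rewrite eV; apply/andP; split; lra.
- move=> x; rewrite /N map_mxM.
  have := krylov_norm_contracts e0 rP (A0 (map_mx (real_complex R) x)).
  rewrite -/A => /le_trans; apply.
  by rewrite gerBl mulr_ge0 ?l1norm_ge0// invr_ge0 ltW.
Qed.

Lemma contraction_sub1_unitmx n (B : 'M[R]_n) N (b : R) :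
  equivalent_norm N -> b < 1 -> (forall x, N (B *m x) <= b * N x) ->
  1%:M - B \in unitmx.
Proof.
move=> eN b1 NB; rewrite -unitmx_tr -row_free_unit; apply: inj_row_free => v.
move=> /(congr1 trmx); rewrite trmx_mul trmxK trmx0 mulmxBl mul1mx.
move=> /eqP; rewrite subr_eq0 => /eqP v1.
have := NB v^T; rewrite -v1 => Nv.
have v0 : vnorm v^T = 0.
  apply/eqP; rewrite eq_le vnorm_ge0 andbT; case: eN => _ h _.
  apply: le_trans (h _) _; nra.
by rewrite -[v]trmxK (vnorm_eq0 v0) trmx0.
Qed.

End ContractingNorm.

(** * Scalar Lyapunov inequality and convergence to zero *)

Section Lyapunov.
Variable R : realType.

(** Convexity of the square at b x + (1 - b) (y / (1 - b)). *)
Lemma sqr_convex (b x y z : R) : 0 <= b < 1 -> 0 <= z -> z <= b * x + y ->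
  z ^+ 2 <= b * x ^+ 2 + y ^+ 2 / (1 - b).
Proof.
move=> /andP[b0 b1] z0 zxy; have d0 : 0 < 1 - b by rewrite subr_gt0.
apply: (@le_trans _ _ ((b * x + y) ^+ 2)); first by rewrite ler_pXn2r// nnegrE (le_trans z0).
rewrite -subr_ge0.
have -> : b * x ^+ 2 + y ^+ 2 / (1 - b) - (b * x + y) ^+ 2
    = b / (1 - b) * ((1 - b) * x - y) ^+ 2 by field; rewrite gt_eqF.
by rewrite mulr_ge0 ?sqr_ge0// divr_ge0// ltW.
Qed.

(* The quantity that 1 / tau has to exceed: the coefficients of D ^+ 2 collected
   in [lyapunov_step]. *)
Definition step_bound (b k1 k2 k3 k4 k5 c : R) : R :=
  2 * c * k3 ^+ 2 / (1 - b) + 4 * k2 ^+ 2 * c * k1 ^+ 2 / (1 - b) ^+ 3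
  + k4 ^+ 2 / (2 * c * (1 - b)) + k5 ^+ 2 / 2.

Definition lyapunov (b k2 c x z E : R) : R :=
  E + c * z ^+ 2 + 4 * k2 ^+ 2 * c / (1 - b) ^+ 2 * x ^+ 2.

(** Here [x] and [z] are the sizes of the lags of u and p, [D] is |d|, [E] the energy and [t] is 1 /
    tau. Half of the decay of x^2 pays for the [k2 * x] fed into [z'], and half of the decay of z^2
    pays, by Young's inequality, for [k4 * z * D]. *)
Lemma lyapunov_step (b k1 k2 k3 k4 k5 c t x x' z z' D E E' : R) :
  0 <= b < 1 -> 0 < c -> 0 <= x' -> 0 <= z' ->
  x' <= b * x + k1 * D -> z' <= b * z + (k2 * x + k3 * D) ->
  E' - E <= - t * D ^+ 2 + k4 * z * D + k5 ^+ 2 / 2 * D ^+ 2 ->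
  (t - step_bound b k1 k2 k3 k4 k5 c) * D ^+ 2 + c * (1 - b) / 2 * z ^+ 2
    + 2 * c * k2 ^+ 2 / (1 - b) * x ^+ 2 <= lyapunov b k2 c x z E - lyapunov b k2 c x' z' E'.
Proof.
move=> b01 c0 x'0 z'0 hx hz hE.
have d0 : 0 < 1 - b by case/andP: b01; rewrite subr_gt0.
have {}hx := sqr_convex b01 x'0 hx.
have {}hz : z' ^+ 2 <= b * z ^+ 2 + 2 * (k2 ^+ 2 * x ^+ 2 + k3 ^+ 2 * D ^+ 2) / (1 - b).
  apply: le_trans (sqr_convex b01 z'0 hz) _.
  rewrite lerD2l ler_pM2r ?invr_gt0//.
  by have := sqr_ge0 (k2 * x - k3 * D); nra.
have hD : 0 <= (c * (1 - b) * z - k4 * D) ^+ 2 / (2 * c * (1 - b)).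
  by rewrite divr_ge0 ?sqr_ge0// ltW// !mulr_gt0.
rewrite -subr_ge0.
(* Four nonnegative terms: the weighted slacks of the three inequalities, and the square behind
   Young's inequality. *)
rewrite [X in 0 <= X](_ : _ =
   (- t * D ^+ 2 + k4 * z * D + k5 ^+ 2 / 2 * D ^+ 2 - (E' - E))
 + c * (b * z ^+ 2 + 2 * (k2 ^+ 2 * x ^+ 2 + k3 ^+ 2 * D ^+ 2) / (1 - b) - z' ^+ 2)
 + 4 * k2 ^+ 2 * c / (1 - b) ^+ 2 * (b * x ^+ 2 + (k1 * D) ^+ 2 / (1 - b) - x' ^+ 2)
 + (c * (1 - b) * z - k4 * D) ^+ 2 / (2 * c * (1 - b))); last first.
  by rewrite /step_bound /lyapunov; field; rewrite !gt_eqF.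
apply: addr_ge0 hD; apply: addr_ge0; first apply: addr_ge0.
- by rewrite subr_ge0.
- by rewrite mulr_ge0 ?subr_ge0// ltW.
- rewrite mulr_ge0 ?subr_ge0// divr_ge0 ?sqr_ge0// mulr_ge0 ?(ltW c0)//.
  by rewrite mulr_ge0// sqr_ge0.
Qed.

(** [V] is nonincreasing and bounded below, hence converges, so its decrements tend to 0. *)
Lemma cvg0_of_lyapunov (c : R) (V y : nat -> R) : 0 < c ->
  (forall n, 0 <= V n) -> (forall n, 0 <= y n) ->
  (forall n, c * y n ^+ 2 <= V n - V n.+1) ->
  y n @[n --> \oo] --> (0 : R).
Proof.
move=> c0 V0 y0 hV.
have cV : cvgn V.
  apply: nonincreasing_is_cvgn; last by exists 0 => _ [n _ <-].
  apply/nonincreasing_seqP => n; rewrite -subr_ge0.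
  by apply: le_trans (hV n); rewrite mulr_ge0 ?sqr_ge0// ltW.
have dV : V n - V n.+1 @[n --> \oo] --> (0 : R).
  by rewrite -(subrr (limn V)); apply: cvgB => //; rewrite cvg_shiftS.
apply/cvgrPdist_lt => e e0; near=> n.
rewrite sub0r normrN ger0_norm//.
rewrite -(@ltr_pXn2r _ 2) ?nnegrE ?(ltW e0)// -(ltr_pM2l c0).
apply: le_lt_trans (hV n) _; apply: le_lt_trans (ler_norm _) _; near: n.
by apply: cvgr0_norm_lt => //; rewrite mulr_gt0// exprn_gt0.
Unshelve. all: by end_near. Qed.

Lemma cvg_vnormD0 n (x y : nat -> 'cV[R]_n) :
  vnorm (x k) @[k --> \oo] --> (0 : R) -> vnorm (y k) @[k --> \oo] --> (0 : R) ->
  vnorm (x k + y k) @[k --> \oo] --> (0 : R).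
Proof.
move=> x0 y0; apply: (squeeze_cvgr (f := fun=> 0) (h := fun k => vnorm (x k) + vnorm (y k))).
- by near=> k; rewrite vnorm_ge0 vnormD.
- exact: cvg_cst.
- by rewrite -[X in _ --> X]addr0; exact: cvgD.
Unshelve. all: by end_near. Qed.

Lemma cvg_vnormM0 m n (A : 'M[R]_(m, n)) (x : nat -> 'cV[R]_n) :
  vnorm (x k) @[k --> \oo] --> (0 : R) ->
  vnorm (A *m x k) @[k --> \oo] --> (0 : R).
Proof.
move=> x0; apply: (squeeze_cvgr (f := fun=> 0) (h := fun k => opnorm A * vnorm (x k))).
- by near=> k; rewrite vnorm_ge0 vnorm_mulmx.
- exact: cvg_cst.
- by rewrite -[X in _ --> X](mulr0 (opnorm A)); apply: cvgM => //; exact: cvg_cst.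
Unshelve. all: by end_near. Qed.

Lemma cvg_vnormZ0 n (a : R) (x : nat -> 'cV[R]_n) :
  vnorm (x k) @[k --> \oo] --> (0 : R) ->
  vnorm (a *: x k) @[k --> \oo] --> (0 : R).
Proof.
by move=> /(@cvg_vnormM0 _ _ a%:M _); under eq_fun do rewrite mul_scalar_mx.
Qed.

Lemma equivalent_norm_cvg0 n (N : 'cV[R]_n -> R) (x : nat -> 'cV[R]_n) :
  equivalent_norm N -> N (x k) @[k --> \oo] --> (0 : R) ->
  vnorm (x k) @[k --> \oo] --> (0 : R).
Proof.
move=> [_ h _] Nx; apply: (squeeze_cvgr (f := fun=> 0) (h := N \o x)) => //.
- by near=> k; rewrite vnorm_ge0 h.
- exact: cvg_cst.
Unshelve. all: by end_near. Qed.

End Lyapunov.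

(** Leaves matrix products unexpanded, so that vector identities become linear goals in the entries
    of such products. *)
Lemma linear_entries (R : pzRingType) m n :
  ((forall (X Y : 'M[R]_(m, n)) i j, ((X + Y) i j = X i j + Y i j)%R) *
   (forall (X : 'M[R]_(m, n)) i j, ((- X) i j = - X i j)%R) *
   (forall a (X : 'M[R]_(m, n)) i j, ((a *: X) i j = a * X i j)%R))%type.
Proof. by do 2?split=> *; rewrite mxE. Qed.

(** * Adjoint gradient, normal equation and minimizer *)

Section Optimality.
Variables (R : realType) (nu ns ng : nat).
Variables (B : 'M[R]_nu) (M : 'M[R]_(nu, ns)) (H : 'M[R]_(ng, nu)).
Variables (F : 'cV[R]_nu) (g : 'cV[R]_ng) (alpha : R).
Hypothesis B1 : 1%:M - B \in unitmx.
Hypothesis alpha0 : 0 <= alpha.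

Let G := invmx (1%:M - B).
Let K := H *m G *m M.
Hypothesis K_inj : injective (fun s : 'cV[R]_ns => K *m s).

Lemma fixpoint_resolvent n (A : 'M[R]_n) (y x : 'cV[R]_n) : 1%:M - A \in unitmx ->
  x = A *m x + y <-> x = invmx (1%:M - A) *m y.
Proof.
move=> A1; split=> [xy|->].
  have <- : (1%:M - A) *m x = y by rewrite mulmxBl mul1mx {1}xy addrC addKr.
  by rewrite mulKmx.
have := mulKVmx A1 y; set z := invmx _ *m y.
by rewrite mulmxBl mul1mx => <-; rewrite addrC subrK.
Qed.

Lemma unitmx_sub1_tr : 1%:M - B^T \in unitmx.
Proof. by rewrite -[X in X - _]trmx1 -linearB unitmx_tr. Qed.

Lemma resolvent_tr : invmx (1%:M - B^T) = G^T.
Proof. by rewrite -[X in X - _]trmx1 -linearB trmx_inv. Qed.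

Lemma stateE s : state B M F s = G *m (M *m s + F).
Proof.
apply: xget_unique => [|u] /=; rewrite -addrA; first exact/fixpoint_resolvent.
by move=> /fixpoint_resolvent; apply.
Qed.

Lemma state_fixpoint s :
  state B M F s = B *m state B M F s + M *m s + F.
Proof. by rewrite -addrA; apply/fixpoint_resolvent => //; exact: stateE. Qed.

Lemma adjoint_stateE s : adjoint_state B M H F g s =
  G^T *m (H^T *m (H *m state B M F s - g)).
Proof.
rewrite -resolvent_tr.
apply: xget_unique => [|p] /=; first exact/(fixpoint_resolvent _ _ unitmx_sub1_tr).
by move=> /(fixpoint_resolvent _ _ unitmx_sub1_tr).
Qed.

Lemma adjoint_state_fixpoint s : adjoint_state B M H F g s =
  B^T *m adjoint_state B M H F g s + H^T *m (H *m state B M F s - g).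
Proof.
apply/(fixpoint_resolvent _ _ unitmx_sub1_tr).
by rewrite resolvent_tr; exact: adjoint_stateE.
Qed.

Definition cost_grad s := M^T *m adjoint_state B M H F g s + alpha *: s.

Lemma cost_gradE s :
  cost_grad s = K^T *m (H *m state B M F s - g) + alpha *: s.
Proof. by rewrite /cost_grad adjoint_stateE !trmx_mul !mulmxA. Qed.

Lemma observed_stateD s d :
  H *m state B M F (s + d) - g = (H *m state B M F s - g) + K *m d.
Proof.
rewrite !stateE (mulmxDr M) addrAC mulmxDr (mulmxDr H) /K -!mulmxA.
by rewrite addrAC.
Qed.

(** Exact because the cost is quadratic; it identifies [cost_grad] as the gradient and K^T K + alpha
    as the Hessian. *)
Lemma cost_expand s d : cost B M H F g alpha (s + d) = cost B M H F g alpha s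
  + dot (cost_grad s) d + 2^-1 * vnorm (K *m d) ^+ 2 + alpha / 2 * vnorm d ^+ 2.
Proof.
rewrite /cost observed_stateD !vnorm_sqrD cost_gradE [dot (_ + alpha *: _) _]dotDl dotZl -(dot_mulmx K).
by field.
Qed.

Let A := K^T *m K + alpha%:M.

(** A v = 0 gives |K v|^2 + alpha |v|^2 = 0, so K v = 0 even when alpha = 0, and K is injective. *)
Lemma normal_eqn_unitmx : A \in unitmx.
Proof.
rewrite -unitmx_tr -row_free_unit; apply: inj_row_free => v.
move=> /(congr1 trmx); rewrite trmx_mul trmxK trmx0 => Av.
suff v0 : v^T = 0 by rewrite -[v]trmxK v0 trmx0.
apply: K_inj; rewrite mulmx0; apply: vnorm_eq0; apply/eqP; rewrite -sqrf_eq0 eq_le sqr_ge0 andbT.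
have : dot v^T (A *m v^T) = 0 by rewrite Av /dot mulmx0 mxE.
rewrite mulmxDl dotDr mul_scalar_mx dotZr -mulmxA dot_mulmx trmxK -!vnorm_sqr.
by have := mulr_ge0 alpha0 (sqr_ge0 (vnorm v^T)); lra.
Qed.

(** The solution [s0] of the normal equation is stationary, and the expansion of the cost around it
    shows that it is the only minimizer. *)
Lemma sigma_ex_stationary : cost_grad (sigma_ex B M H F g alpha) = 0.
Proof.
pose s0 : 'cV[R]_ns := - (invmx A *m (K^T *m (H *m state B M F 0 - g))).
have s00 : cost_grad s0 = 0.
  rewrite cost_gradE -[s0 in state _ _ _ s0]add0r observed_stateD mulmxDr -addrA.
  rewrite mulmxA -mul_scalar_mx -mulmxDl -/A /s0 mulmxN mulKVmx ?normal_eqn_unitmx//.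
  by rewrite subrr.
suff -> : sigma_ex B M H F g alpha = s0 by [].
have cost0 d : cost B M H F g alpha (s0 + d) = cost B M H F g alpha s0
    + 2^-1 * vnorm (K *m d) ^+ 2 + alpha / 2 * vnorm d ^+ 2.
  by rewrite cost_expand s00 /dot trmx0 mul0mx mxE addr0.
apply: xget_unique => [s|s smin] /=.
  rewrite -[s](subrK s0) [_ + s0]addrC cost0 -addrA lerDl.
  by apply: addr_ge0; rewrite mulr_ge0 ?sqr_ge0// ?divr_ge0 ?invr_ge0.
apply/eqP; rewrite -subr_eq0; apply/eqP; apply: K_inj; rewrite mulmx0; apply: vnorm_eq0.
have := smin s0; rewrite -{1}[s](subrK s0) [_ + s0]addrC cost0.
have := mulr_ge0 alpha0 (sqr_ge0 (vnorm (s - s0))).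
have := sqr_ge0 (vnorm (K *m (s - s0))) => h1 h2 h3.
by apply/eqP; rewrite -sqrf_eq0 eq_le h1 andbT; lra.
Qed.

(** * Error recursions and convergence of the iterates *)

Variable tau : R.
Hypothesis tau0 : 0 < tau.
(** Kept abstract to serve both the norms of [contracting_norm] and the Euclidean norm. [k1], [k2]
    and [k3] bound what feeds the lags, [k4] the effect of the adjoint lag on the energy, [k5] the
    size of K. *)
Variables (N1 N2 : 'cV[R]_nu -> R) (b k1 k2 k3 k4 k5 c : R).
Hypotheses (eN1 : equivalent_norm N1) (eN2 : equivalent_norm N2).
Hypothesis b01 : 0 <= b < 1.
Hypothesis N1B : forall x, N1 (B *m x) <= b * N1 x.
Hypothesis N2B : forall x, N2 (B^T *m x) <= b * N2 x.
Hypothesis N1M : forall d, N1 (B *m G *m M *m d) <= k1 * vnorm d.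
Hypothesis N2H : forall x, N2 (H^T *m H *m x) <= k2 * N1 x.
Hypothesis N2K : forall d, N2 (G^T *m H^T *m K *m d) <= k3 * vnorm d.
Hypothesis dotN2M : forall q d, dot q (M *m d) <= k4 * N2 q * vnorm d.
Hypothesis vnormK : forall d, vnorm (K *m d) <= k5 * vnorm d.
Hypotheses (k2_gt0 : 0 < k2) (c_gt0 : 0 < c).
Hypothesis tau_bound : step_bound b k1 k2 k3 k4 k5 c < tau^-1.

(** The derivative of the adjoint state with respect to sigma. *)
Let S := G^T *m H^T *m K.

Section Iterates.
Variables (sigma : nat -> 'cV[R]_ns) (u p : nat -> 'cV[R]_nu).
Hypothesis it : one_shot_iterates B M H F g alpha tau sigma u p.

Let se := sigma_ex B M H F g alpha.
Let e n := sigma n - se.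
Let d n := e n.+1 - e n.
Let q n := p n - adjoint_state B M H F g se.
(* The distances of u and p from their quasi-static values for the current sigma. *)
Let ut n := u n - state B M F se - G *m M *m e n.
Let pt n := q n - S *m e n.

Lemma sigma_increment n : d n = - tau *: (M^T *m q n + alpha *: e n.+1).
Proof.
have [h _ _] := it n; have := sigma_ex_stationary; rewrite /cost_grad -/se.
rewrite /d /e /q mulmxBr; move: (M^T *m p n) (M^T *m adjoint_state _ _ _ _ _ _) h.
move=> v w /matrixP h /matrixP h0; apply/matrixP => i j.
by have := h i j; have := congr1 ( *%R tau) (h0 i j); rewrite !mxE; lra.
Qed.

(** y = G M e solves y = B y + M e, and u is updated with the new sigma, so the M e terms cancel and
    what remains carries a factor B. *)
Lemma ut_step n : ut n.+1 = B *m ut n - B *m G *m M *m d n.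
Proof.
have GM (x : 'cV[R]_ns) : G *m M *m x = B *m (G *m M *m x) + M *m x.
  by apply/fixpoint_resolvent => //; rewrite mulmxA.
have Me : M *m e n.+1 = M *m sigma n.+1 - M *m se by rewrite mulmxBr.
have But : B *m ut n = B *m u n - B *m state B M F se - B *m (G *m M *m e n).
  by rewrite !mulmxBr.
have Bd : B *m G *m M *m d n = B *m (G *m M *m e n.+1) - B *m (G *m M *m e n).
  by rewrite /d !mulmxBr !mulmxA.
have [_ h _] := it n; apply/matrixP => i j.
have := congr1 (fun x => fun_of_matrix x i j) (state_fixpoint se).
have := congr1 (fun x => fun_of_matrix x i j) (GM (e n.+1)).
have := congr1 (fun x => fun_of_matrix x i j) h.
by rewrite But Bd Me /ut !linear_entries /= {GM Me But Bd h}; lra.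
Qed.

(** The update of p uses the old u and so matches the quasi-static equation at the old sigma; moving
    to the new sigma costs the full S d, without a factor B^T. *)
Lemma pt_step n : pt n.+1 = B^T *m pt n + H^T *m H *m ut n - S *m d n.
Proof.
have SE (x : 'cV[R]_ns) : S *m x = B^T *m (S *m x) + H^T *m H *m (G *m M *m x).
  by apply/(fixpoint_resolvent _ _ unitmx_sub1_tr); rewrite resolvent_tr /S /K !mulmxA.
have Bpt : B^T *m pt n = B^T *m p n - B^T *m adjoint_state B M H F g se
    - B^T *m (S *m e n) by rewrite !mulmxBr.
have Hut : H^T *m H *m ut n = H^T *m (H *m u n - g)
    - H^T *m (H *m state B M F se - g) - H^T *m H *m (G *m M *m e n).
  rewrite [LHS]mulmxBr (mulmxBr _ (u n)) !(mulmxBr H^T) opprB addrA subrK.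
  by rewrite !mulmxA.
have [_ _ h] := it n; apply/matrixP => i j.
have := congr1 (fun x => fun_of_matrix x i j) (adjoint_state_fixpoint se).
have := congr1 (fun x => fun_of_matrix x i j) (SE (e n)).
have := congr1 (fun x => fun_of_matrix x i j) h.
by rewrite Bpt Hut /pt /q /d !(mulmxBr S) !linear_entries /= {SE Bpt Hut h}; lra.
Qed.

(** By [cost_expand] and stationarity, the excess of the cost at [sigma n] over its minimum. *)
Let energy n := 2^-1 * vnorm (K *m e n) ^+ 2 + alpha / 2 * vnorm (e n) ^+ 2.

(** The sigma step is paired with d. The explicit K part leaves |K d|^2 / 2, the source of [k5]; the
    implicit alpha part leaves - alpha |d|^2 / 2, whose sign is favourable, so alpha does not enter
    the bound. *)
Lemma energy_step n : energy n.+1 - energy n <=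
  - tau^-1 * vnorm (d n) ^+ 2 + k4 * N2 (pt n) * vnorm (d n)
    + k5 ^+ 2 / 2 * vnorm (d n) ^+ 2.
Proof.
have eS : e n.+1 = e n + d n by rewrite addrC subrK.
have qE : q n = pt n + S *m e n by rewrite subrK.
have dd : dot (d n) (d n) = - tau * (dot (pt n) (M *m d n)
    + dot (K *m e n) (K *m d n) + alpha * dot (e n.+1) (d n)).
  rewrite {1}sigma_increment dotZl dotDl dotZl -dot_mulmx qE dotDl; congr (_ * (_ + _ + _)).
  by rewrite !dot_mulmx /S /K !trmx_mul !mulmxA.
have hM := dotN2M (pt n) (- d n); rewrite mulmxN dotNr vnormN in hM.
have hK : vnorm (K *m d n) ^+ 2 <= k5 ^+ 2 * vnorm (d n) ^+ 2.
  by rewrite -exprMn ler_pXn2r// ?nnegrE ?vnorm_ge0// (le_trans (vnorm_ge0 _) (vnormK _)).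
have hd := mulr_ge0 alpha0 (sqr_ge0 (vnorm (d n))).
have ee : energy n.+1 - energy n = dot (K *m e n) (K *m d n)
    + alpha * dot (e n.+1) (d n) + 2^-1 * vnorm (K *m d n) ^+ 2
    - alpha / 2 * vnorm (d n) ^+ 2.
  rewrite /energy eS mulmxDr (vnorm_sqrD (e n)) (vnorm_sqrD (K *m e n)).
  by rewrite (dotDl (e n) (d n)) -vnorm_sqr; field.
have td : - tau^-1 * vnorm (d n) ^+ 2 = dot (pt n) (M *m d n)
    + dot (K *m e n) (K *m d n) + alpha * dot (e n.+1) (d n).
  by rewrite vnorm_sqr dd; field; rewrite gt_eqF.
by rewrite ee td; lra.
Qed.

Lemma one_shot_errors_cvg0 :
  [/\ vnorm (d n) @[n --> \oo] --> (0 : R), vnorm (ut n) @[n --> \oo] --> (0 : R) &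
      vnorm (pt n) @[n --> \oo] --> (0 : R)].
Proof.
pose V n := lyapunov b k2 c (N1 (ut n)) (N2 (pt n)) (energy n).
have b1 : 0 < 1 - b by case/andP: b01; rewrite subr_gt0.
have g0 : 0 < tau^-1 - step_bound b k1 k2 k3 k4 k5 c by rewrite subr_gt0.
have h1 : 0 < c * (1 - b) / 2 by rewrite divr_gt0// mulr_gt0.
have h2 : 0 < 2 * c * k2 ^+ 2 / (1 - b).
  by rewrite divr_gt0// !mulr_gt0// exprn_gt0.
have V0 n : 0 <= V n.
  apply: addr_ge0; first apply: addr_ge0.
  - by apply: addr_ge0; apply: mulr_ge0; rewrite ?sqr_ge0// ?invr_ge0 ?divr_ge0.
  - by rewrite mulr_ge0 ?sqr_ge0// ltW.
  - rewrite mulr_ge0 ?sqr_ge0// divr_ge0 ?sqr_ge0// mulr_ge0 ?(ltW c_gt0)//.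
    by rewrite mulr_ge0// sqr_ge0.
have NB (N : 'cV[R]_nu -> R) x y : equivalent_norm N -> N (x - y) <= N x + N y by case.
have step n : (tau^-1 - step_bound b k1 k2 k3 k4 k5 c) * vnorm (d n) ^+ 2
    + c * (1 - b) / 2 * N2 (pt n) ^+ 2
    + 2 * c * k2 ^+ 2 / (1 - b) * N1 (ut n) ^+ 2 <= V n - V n.+1.
  apply: lyapunov_step; rewrite ?equivalent_norm_ge0 ?energy_step//.
  - rewrite ut_step; apply: le_trans (NB _ _ _ eN1) _; exact: lerD.
  (* Regrouped as B^T pt - (S d - H^T H ut), since [equivalent_norm] bounds differences. *)
  - rewrite pt_step -addrA -[X in _ + X]opprB.
    apply: le_trans (NB _ _ _ eN2) _; rewrite lerD//.
    by apply: le_trans (NB _ _ _ eN2) _; rewrite addrC lerD.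
have p1 n := mulr_ge0 (ltW g0) (sqr_ge0 (vnorm (d n))).
have p2 n := mulr_ge0 (ltW h1) (sqr_ge0 (N2 (pt n))).
have p3 n := mulr_ge0 (ltW h2) (sqr_ge0 (N1 (ut n))).
split.
- apply: (cvg0_of_lyapunov g0 V0) => n; first exact: vnorm_ge0.
  by apply: le_trans (step n); have := p2 n; have := p3 n; lra.
- apply: (equivalent_norm_cvg0 eN1); apply: (cvg0_of_lyapunov h2 V0) => n.
    exact: equivalent_norm_ge0.
  by apply: le_trans (step n); have := p1 n; have := p2 n; lra.
- apply: (equivalent_norm_cvg0 eN2); apply: (cvg0_of_lyapunov h1 V0) => n.
    exact: equivalent_norm_ge0.
  by apply: le_trans (step n); have := p1 n; have := p3 n; lra.
Qed.

(** Solving the sigma step for e gives A e = - d / tau - M^T pt - alpha d, where every term on the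
    right tends to 0, and A is invertible. *)
Lemma sigma_error_cvg0 : vnorm (e n) @[n --> \oo] --> (0 : R).
Proof.
have [d0 _ p0] := one_shot_errors_cvg0.
have eE n : e n = invmx A *m
    ((- tau^-1) *: d n + (- M^T *m pt n + (- alpha) *: d n)).
  rewrite -[LHS](mulKmx normal_eqn_unitmx); congr (_ *m _).
  have eS : e n.+1 = e n + d n by rewrite addrC subrK.
  have qE : q n = pt n + S *m e n by rewrite subrK.
  have Ae : A *m e n = M^T *m (S *m e n) + alpha *: e n.
    by rewrite mulmxDl mul_scalar_mx /S /K !trmx_mul !mulmxA.
  rewrite {1}sigma_increment scalerA mulNr mulrN opprK mulVf ?gt_eqF// scale1r.
  rewrite Ae eS qE (mulmxDr M^T (pt n)) (scalerDr alpha (e n)) mulNmx; apply/matrixP => i j.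
  by rewrite !linear_entries; ring.
under eq_fun do rewrite eE; apply: cvg_vnormM0; apply: cvg_vnormD0.
  exact: cvg_vnormZ0.
by apply: cvg_vnormD0; [exact: cvg_vnormM0 | exact: cvg_vnormZ0].
Qed.

End Iterates.

Lemma one_shot_converges_of_step_bound : one_shot_converges B M H F g alpha tau.
Proof.
move=> sigma u p it; have [_ ut0 pt0] := one_shot_errors_cvg0 it.
have e0 := sigma_error_cvg0 it.
split; apply: cvg_vnorm => //.
- under eq_fun => n do rewrite -[u n - _](subrK (G *m M *m (sigma n - sigma_ex B M H F g alpha))).
  exact: (cvg_vnormD0 ut0 (cvg_vnormM0 (G *m M) e0)).
- under eq_fun => n do rewrite -[p n - _](subrK (S *m (sigma n - sigma_ex B M H F g alpha))).
  exact: (cvg_vnormD0 pt0 (cvg_vnormM0 S e0)).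
Qed.

End Optimality.

(** * Choice of norms and constants *)

Lemma equivalent_norm_mulmx (R : realType) m n (N : 'cV[R]_n -> R) (A : 'M[R]_(n, m)) :
  equivalent_norm N -> exists2 k, 0 <= k & forall x, N (A *m x) <= k * vnorm x.
Proof.
case=> _ _ [k k0 kP]; exists (k * opnorm A) => [|x].
  by rewrite mulr_ge0 ?opnorm_ge0.
by apply: le_trans (kP _) _; rewrite -mulrA ler_wpM2l// vnorm_mulmx.
Qed.

Lemma vnorm_resolvent (R : realType) n (A : 'M[R]_n) (b : R) x :
  (forall y, vnorm (A *m y) <= b * vnorm y) -> b < 1 ->
  vnorm (invmx (1%:M - A) *m x) <= (1 - b)^-1 * vnorm x.
Proof.
move=> Ab b1.
have A1 := contraction_sub1_unitmx (equivalent_norm_vnorm R n) b1 Ab.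
rewrite mulrC ler_pdivlMr ?subr_gt0//; set y := invmx _ *m x.
have yE : y = A *m y + x by apply/fixpoint_resolvent.
have : vnorm y <= b * vnorm y + vnorm x.
  by rewrite {1}yE; apply: le_trans (vnormD _ _) _; rewrite lerD2r.
by lra.
Qed.

Lemma one_shot_converges_small_step (R : realType) (nu ns ng : nat)
    (B : 'M[R]_nu) (M : 'M[R]_(nu, ns)) (H : 'M[R]_(ng, nu))
    (F : 'cV[R]_nu) (g : 'cV[R]_ng) (alpha : R) :
  admissible B M H alpha ->
  exists2 tau0 : R, 0 < tau0 &
    forall tau : R, 0 < tau < tau0 -> one_shot_converges B M H F g alpha tau.
Proof.
case=> alpha0 rB K_inj.
have [N1 [b1 [eN1 /andP[b1_ge0 b1_lt1] N1B]]] := contracting_norm rB.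
have rBt : spectral_radius B^T < 1 by rewrite spectral_radius_trmx.
have [N2 [b2 [eN2 /andP[b2_ge0 b2_lt1] N2B]]] := contracting_norm rBt.
pose b := Num.max b1 b2.
have b01 : 0 <= b < 1 by rewrite le_max b1_ge0 gt_max b1_lt1.
have B1 := contraction_sub1_unitmx eN1 b1_lt1 N1B.
pose G := invmx (1%:M - B); pose K := H *m G *m M.
have [k1 _ N1M] := equivalent_norm_mulmx (B *m G *m M) eN1.
have [k2 k2_ge0 N2H] := equivalent_norm_mulmx (H^T *m H) eN2.
have [k3 _ N2K] := equivalent_norm_mulmx (G^T *m H^T *m K) eN2.
have N1_ge x : vnorm x <= N1 x by case: eN1.
have N2_ge x : vnorm x <= N2 x by case: eN2.
(* [k2 + 1] secures the strict positivity asked of that constant, and the maximum with 1 below keeps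
   the threshold positive. *)
pose X := step_bound b k1 (k2 + 1) k3 (opnorm M) (opnorm K) 1.
have X0 : 0 < Num.max X 1 by rewrite lt_max ltr01 orbT.
exists (Num.max X 1)^-1; first by rewrite invr_gt0.
move=> tau /andP[tau0 tauX].
apply: (@one_shot_converges_of_step_bound _ _ _ _ _ _ _ _ _ _ B1 alpha0 K_inj _ tau0
  N1 N2 b k1 (k2 + 1) k3 (opnorm M) (opnorm K) 1) => //.
- move=> x; apply: le_trans (N1B x) _.
  by rewrite ler_wpM2r ?(equivalent_norm_ge0 _ eN1)// le_max lexx.
- move=> x; apply: le_trans (N2B x) _.
  by rewrite ler_wpM2r ?(equivalent_norm_ge0 _ eN2)// le_max lexx orbT.
- move=> x; apply: le_trans (N2H x) _.
  by apply: ler_pM => //; rewrite ?vnorm_ge0 ?lerDl.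
- move=> q d; apply: le_trans (dot_le_vnorm _ _) _.
  rewrite [_ * N2 q]mulrC -mulrA.
  by apply: ler_pM; rewrite ?vnorm_ge0 ?N2_ge ?vnorm_mulmx.
- by move=> d; exact: (vnorm_mulmx K d).
- by rewrite ltr_wpDl.
- apply: (@le_lt_trans _ _ (Num.max X 1)); first by rewrite le_max lexx.
  by rewrite -[ltLHS]invrK ltf_pV2 ?posrE ?invr_gt0.
Qed.

Lemma one_shot_converges_opnorm (R : realType) (nu ns ng : nat)
    (B : 'M[R]_nu) (M : 'M[R]_(nu, ns)) (H : 'M[R]_(ng, nu))
    (F : 'cV[R]_nu) (g : 'cV[R]_ng) (alpha tau : R) :
  admissible B M H alpha -> opnorm B < 1 -> 0 < tau ->
  opnorm H ^+ 2 * opnorm M ^+ 2 / (1 - opnorm B) ^+ 4 * 7 < tau^-1 ->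
  one_shot_converges B M H F g alpha tau.
Proof.
case=> alpha0 _ K_inj.
have := opnorm_ge0 B; have := @vnorm_mulmx _ _ _ B; have := @vnorm_trmulmx _ _ _ B.
set b := opnorm B => BtP BP b0 b1 tau0 hs.
have := opnorm_ge0 H; have := @vnorm_mulmx _ _ _ H; have := @vnorm_trmulmx _ _ _ H.
have := opnorm_ge0 M; have := @vnorm_mulmx _ _ _ M.
move: hs; set h := opnorm H; set m := opnorm M => hs MP m0 HtP HP h0.
have d0 : 0 < 1 - b by rewrite subr_gt0.
have d1 : 1 - b <= 1 by rewrite gerBl.
have B1 := contraction_sub1_unitmx (equivalent_norm_vnorm R nu) b1 BP.
pose G := invmx (1%:M - B); pose K := H *m G *m M.
have GP x : vnorm (G *m x) <= (1 - b)^-1 * vnorm x by exact: vnorm_resolvent.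
have GtP x : vnorm (G^T *m x) <= (1 - b)^-1 * vnorm x.
  by rewrite -resolvent_tr; exact: vnorm_resolvent.
have GMP x : vnorm (G *m M *m x) <= m / (1 - b) * vnorm x.
  rewrite -mulmxA (mulrC m) -mulrA; apply: le_trans (GP _) _.
  by rewrite ler_wpM2l// invr_ge0 ltW.
have KP x : vnorm (K *m x) <= h * m / (1 - b) * vnorm x.
  rewrite /K -!mulmxA -!mulrA; apply: le_trans (HP _) _.
  by rewrite ler_wpM2l// mulmxA mulrA.
(* [a] replaces [h ^+ 2] so that the weights stay positive when [h = 0]. *)
pose gap := tau^-1 - h ^+ 2 * m ^+ 2 / (1 - b) ^+ 4 * 7.
pose a := h ^+ 2 + gap * (1 - b) ^+ 4 / (7 * (m ^+ 2 + 1)).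
have m1 : 0 < m ^+ 2 + 1 by rewrite ltr_wpDl// sqr_ge0.
have gap0 : 0 < gap by rewrite subr_gt0.
have a_gt : h ^+ 2 < a by rewrite ltrDl divr_gt0// mulr_gt0// exprn_gt0.
have a0 : 0 < a by apply: le_lt_trans a_gt; exact: sqr_ge0.
(* Replacing h^2 by [a] costs gap m^2 / (m^2 + 1), strictly less than the gap. *)
have aP : a * m ^+ 2 / (1 - b) ^+ 4 * 7 < tau^-1.
  have -> : tau^-1 = gap + h ^+ 2 * m ^+ 2 / (1 - b) ^+ 4 * 7 by rewrite subrK.
  have -> : a * m ^+ 2 / (1 - b) ^+ 4 * 7 =
      gap * (m ^+ 2 / (m ^+ 2 + 1)) + h ^+ 2 * m ^+ 2 / (1 - b) ^+ 4 * 7.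
    by rewrite /a; field; rewrite !gt_eqF.
  by rewrite ltrD2r gtr_pMr// ltr_pdivrMr// mul1r ltrDl.
(* With c = (1 - b)^2 / a the first three terms of [step_bound] are 2, 4 and 1/2 times a m^2 / (1 -
   b)^3, and the last is at most 1/2 of it: 7 in total. *)
apply: (@one_shot_converges_of_step_bound _ _ _ _ _ _ _ _ _ _ B1 alpha0 K_inj _ tau0
  (@vnorm R nu) (@vnorm R nu) b (m / (1 - b)) a (a * m / (1 - b) ^+ 2) m
  (h * m / (1 - b)) ((1 - b) ^+ 2 / a)) => //; try exact: equivalent_norm_vnorm.
- by rewrite b0.
- move=> x; rewrite -!mulmxA; apply: le_trans (BP _) _.
  rewrite mulmxA; apply: le_trans (GMP x).
  by rewrite ler_piMl ?vnorm_ge0// ltW.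
- move=> x; rewrite -mulmxA; apply: le_trans (HtP _) _.
  apply: (@le_trans _ _ (h ^+ 2 * vnorm x)); first by rewrite expr2 -mulrA ler_wpM2l.
  by rewrite ler_wpM2r ?vnorm_ge0// ltW.
- move=> x; rewrite -!(mulmxA G^T) -(mulmxA H^T); apply: le_trans (GtP _) _.
  rewrite mulrC ler_pdivrMr//; apply: le_trans (HtP _) _.
  apply: (@le_trans _ _ (h * (h * m / (1 - b) * vnorm x))); first by rewrite ler_wpM2l.
  rewrite (_ : h * _ = h ^+ 2 * (m / (1 - b) * vnorm x)); last by ring.
  rewrite (_ : _ * (1 - b) = a * (m / (1 - b) * vnorm x)); last first.
    by field; rewrite gt_eqF.
  by rewrite ler_wpM2r ?(ltW a_gt)// mulr_ge0 ?vnorm_ge0// divr_ge0// ltW.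
- move=> q d; apply: le_trans (dot_le_vnorm _ _) _.
  by rewrite [m * _]mulrC -mulrA ler_wpM2l ?vnorm_ge0.
- by rewrite divr_gt0// exprn_gt0.
- apply: le_lt_trans aP.
  rewrite -subr_ge0 [X in 0 <= X](_ : _ = m ^+ 2 / (1 - b) ^+ 4 *
    (7 * a - (13 / 2) * a * (1 - b) - h ^+ 2 * (1 - b) ^+ 2 / 2)); last first.
    by rewrite /step_bound; field; rewrite !gt_eqF.
  rewrite mulr_ge0// ?divr_ge0 ?sqr_ge0 ?exprn_ge0 ?(ltW d0)//.
  have : a * (1 - b) <= a by rewrite ler_piMr// ltW.
  have : h ^+ 2 * (1 - b) ^+ 2 <= a.
    by rewrite -[leRHS]mulr1 ler_pM ?sqr_ge0 ?(ltW a_gt)// exprn_ile1// ltW.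
  by lra.
Qed.

(* In the last hypothesis the reciprocal is taken in \bar R, where 0^-1 = +oo:
   the sum vanishes when ns = 0 and alpha = 0, and tau is then unrestricted. *)
Theorem theorem3p9 (R : realType) :
  (forall (nu ns ng : nat)
     (B : 'M[R]_nu) (M : 'M[R]_(nu, ns)) (H : 'M[R]_(ng, nu))
     (F : 'cV[R]_nu) (g : 'cV[R]_ng) (alpha : R),
     admissible B M H alpha ->
     exists2 tau0 : R, 0 < tau0 &
       forall tau : R, 0 < tau < tau0 ->
         one_shot_converges B M H F g alpha tau)
  /\
  (exists (P1 : R -> R) (C : R),
     [/\ piecewise_poly 4 P1,
         forall x : R, 0 <= x < 1 -> 0 < P1 x,
         0 < C &
         forall (nu ns ng : nat)
           (B : 'M[R]_nu) (M : 'M[R]_(nu, ns)) (H : 'M[R]_(ng, nu))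
           (F : 'cV[R]_nu) (g : 'cV[R]_ng) (alpha : R),
           admissible B M H alpha -> opnorm B < 1 ->
           forall tau : R, 0 < tau ->
             (tau%:E < (((opnorm H ^+ 2 * opnorm M ^+ 2 / (1 - opnorm B) ^+ 4)
                          * P1 (opnorm B) + C * alpha)%:E)^-1)%E ->
             one_shot_converges B M H F g alpha tau]).
Proof.
split; first exact: one_shot_converges_small_step.
exists (fun=> 7), 1; split => //.
- exists 1%N, (fun=> `[0, 1[%R), (fun=> 7%:P); split=> //.
  + by apply/seteqP; split=> [x [_ _] /=|x /= x01]; [|exists ord0 => //=]; rewrite in_itv.
  + by move=> i j _ _ _; rewrite (ord1 i) (ord1 j).
  + by move=> _; apply: leq_trans (size_polyC_leq1 _) _.
  + by move=> i x _; rewrite hornerC.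
- move=> nu ns ng B M H F g alpha adm B1 tau tau0 htau.
  apply: one_shot_converges_opnorm => //.
  have alpha0 : 0 <= alpha by case: adm.
  have : 0 <= opnorm H ^+ 2 * opnorm M ^+ 2 / (1 - opnorm B) ^+ 4 * 7.
    by rewrite !mulr_ge0 ?invr_ge0 ?exprn_ge0 ?opnorm_ge0// subr_ge0 ltW.
  set s := _ * 7 => s_ge0; apply: (@le_lt_trans _ _ (s + 1 * alpha)).
    by rewrite mul1r lerDl.
  (* If the sum vanishes, its reciprocal is +oo and the goal becomes [0 < tau^-1]. *)
  move: htau; rewrite -/s inver; case: eqVneq => [-> _|s0].
    by rewrite invr_gt0.
  have s1 : 0 < s + 1 * alpha.
    by rewrite lt_def s0 addr_ge0 ?mul1r.
  by rewrite lte_fin -[X in _ -> X < _]invrK ltf_pV2 ?posrE ?invr_gt0.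
Qed.
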